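(* Let $\mathcal L=\langle F,M,\mathrm{mng},\models\rangle$ be any logic with formula algebra $\mathfrak F$. Define, for $H\subseteq F\times F$ and $\tau,\sigma\in F$: $H\vdash_{\mathcal L}\langle\tau,\sigma\rangle$ iff for every endomorphism $f$ of $\mathfrak F$ and every $\mathfrak M\in M$, if $f(H)\subseteq\ker(\mathrm{mng}_{\mathfrak M})$ then $\langle f\tau,f\sigma\rangle\in\ker(\mathrm{mng}_{\mathfrak M})$, where $f(H)=\{\langle f\phi,f\psi\rangle:\langle\phi,\psi\rangle\in H\}$. Then: (i) $\vdash_{\mathcal L}$ is the largest substitutional and sound deductive system in $\mathcal L$ (i.e. it is substitutional and sound, and every substitutional and sound deductive system $\vdash$ in $\mathcal L$ satisfies $\vdash\subseteq\vdash_{\mathcal L}$); (ii) for all $H\subseteq F\times F$ and $\phi,\psi\in F$: $H\vdash_{\mathcal L}\langle\phi,\psi\rangle$ iff $\mathrm{Alg}_m(\mathcal L)\models\bigwedge H\to[\phi=\psi]$.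
   Context: A logic is a tuple $\mathcal L=\langle F,M,\mathrm{mng},\models\rangle$ where: $\mathrm{Cn}$ is a similarity type (the connectives) and $P$ is a set (the atomic formulas) such that no $p\in P$ is a term built by the connectives from elements of $P\setminus\{p\}$; $F$ is the universe of the term algebra $\mathfrak F=\mathfrak F(P,\mathrm{Cn})$; $M$ is a class (of models); $\models\subseteq M\times F$; and $\mathrm{mng}$ assigns to each $\mathfrak M\in M$ a homomorphism $\mathrm{mng}_{\mathfrak M}$ from $\mathfrak F$ into some algebra of type $\mathrm{Cn}$, such that $\mathrm{mng}_{\mathfrak M}(\phi)=\mathrm{mng}_{\mathfrak M}(\psi)$ and $\mathfrak M\models\phi$ imply $\mathfrak M\models\psi$. $\mathrm{Alg}_m(\mathcal L)=\{\mathrm{mng}_{\mathfrak M}(\mathfrak F):\mathfrak M\in M\}$. A (2-dimensional) deductive system in $\mathcal L$ is a consequence relation $\vdash$ (in the sense of Blok–Pigozzi) between subsets $H\subseteq F\times F$ and elements of $F\times F$. A set $\Sigma\subseteq F\times F$ is closed under $\vdash$ if $H\subseteq\Sigma$ and $H\vdash\langle\tau,\sigma\rangle$ imply $\langle\tau,\sigma\rangle\in\Sigma$. $\vdash$ is sound if $\ker(\mathrm{mng}_{\mathfrak M})$ is closed under $\vdash$ for every $\mathfrak M\in M$, and substitutional if $H\vdash\langle\tau,\sigma\rangle$ implies $f(H)\vdash\langle f\tau,f\sigma\rangle$ for every endomorphism $f$ of $\mathfrak F$. $\mathrm{Alg}_m(\mathcal L)\models\bigwedge H\to[\phi=\psi]$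 means: for every $\mathfrak A\in\mathrm{Alg}_m(\mathcal L)$ and every homomorphism $e:\mathfrak F\to\mathfrak A$ (evaluation of the atomic formulas as variables), if $e(\alpha)=e(\beta)$ for all $\langle\alpha,\beta\rangle\in H$ then $e(\phi)=e(\psi)$. *)

(* Defs.v *)
From mathcomp Require Import all_boot.
From mathcomp Require Import boolp classical_sets.

Set Implicit Arguments.
Unset Strict Implicit.
Unset Printing Implicit Defensive.

Local Open Scope classical_set_scope.

Record signature := Signature {
  conn :> Type;
  arity : conn -> nat
}.

Record algebra (Cn : signature) := Algebra {
  carrier :> Type;
  op : forall c : Cn, ('I_(arity c) -> carrier) -> carrier
}.
Arguments op {Cn} _ c _.

Definition is_hom (Cn : signature) (A B : algebra Cn) (h : A -> B) : Prop :=
  forall (c : Cn) (a : 'I_(arity c) -> A),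
    h (op A c a) = op B c (fun i => h (a i)).

(* Freeness of the inductive type subsumes the requirement that no atomic
   formula is a term built from the other atomic formulas. *)
Inductive term (Cn : signature) (P : Type) : Type :=
| Atom (p : P)
| App (c : Cn) (t : 'I_(arity c) -> term Cn P).

Definition term_algebra (Cn : signature) (P : Type) : algebra Cn :=
  @Algebra Cn (term Cn P) (@App Cn P).

Lemma range_op_closed (Cn : signature) (A B : algebra Cn) (h : A -> B)
    (hom_h : is_hom h) (c : Cn) (b : 'I_(arity c) -> {y : B | range h y}) :
  range h (op B c (fun i => sval (b i))).
Proof.
have /fin_all_exists[a ha] i : exists x, h x = sval (b i).
  by case: (b i) => y /= [x _ hx]; exists x.
exists (op A c a) => //.
by rewrite hom_h; congr (op B c _); apply/funext.
Qed.

Definition hom_image (Cn : signature) (A B : algebra Cn) (h : A -> B)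
    (hom_h : is_hom h) : algebra Cn :=
  @Algebra Cn {y : B | range h y}
    (fun c b => exist _ (op B c (fun i => sval (b i))) (range_op_closed hom_h b)).

Record logic := Logic {
  Cn : signature;
  atom : Type;
  model : Type;
  sat : model -> term_algebra Cn atom -> Prop;
  mng_alg : model -> algebra Cn;
  mng : forall M : model, term_algebra Cn atom -> mng_alg M;
  mng_hom : forall M : model, is_hom (@mng M);
  mng_sat : forall (M : model) (phi psi : term_algebra Cn atom),
    mng M phi = mng M psi -> sat M phi -> sat M psi
}.
Arguments mng {l} M _.
Arguments mng_hom {l} M.

Definition formula_algebra (L : logic) : algebra (Cn L) :=
  term_algebra (Cn L) (atom L).
Notation formula L := (carrier (formula_algebra L)).

Definition ker (T U : Type) (h : T -> U) : set (T * T) :=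
  [set e | h e.1 = h e.2].

Definition pair_map (T U : Type) (f : T -> U) (e : T * T) : U * U :=
  (f e.1, f e.2).

Definition Alg_m (L : logic) : algebra (Cn L) -> Prop :=
  fun A => exists M : model L, A = hom_image (mng_hom M).

Section Systems.
Variable L : logic.

Definition relation2 := set (formula L * formula L) -> set (formula L * formula L).

(* The Blok-Pigozzi axioms of a consequence relation: reflexivity, monotonicity
   and cut.  Structurality is the separate notion [substitutional], and
   finitarity is not imposed, as it fails for [entails] in general. *)
Definition deductive_system (D : relation2) : Prop :=
  [/\ forall H e, H e -> D H e,
      forall H K e, H `<=` K -> D H e -> D K e
    & forall H K e, D H e -> (forall e', H e' -> D K e') -> D K e].

Definition closed_under (D : relation2) (S : set (formula L * formula L)) : Prop :=
  forall H e, H `<=` S -> D H e -> S e.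

Definition sound (D : relation2) : Prop :=
  forall M : model L, closed_under D (ker (mng M)).

Definition substitutional (D : relation2) : Prop :=
  forall (f : formula L -> formula L), is_hom f ->
  forall H e, D H e -> D (pair_map f @` H) (pair_map f e).

Definition entails : relation2 := fun H e =>
  forall (f : formula L -> formula L), is_hom f ->
  forall M : model L, pair_map f @` H `<=` ker (mng M) ->
    ker (mng M) (pair_map f e).

End Systems.

Definition valid_implication (Cn : signature) (P : Type)
    (K : algebra Cn -> Prop)
    (H : set (term_algebra Cn P * term_algebra Cn P))
    (phi psi : term_algebra Cn P) : Prop :=
  forall A : algebra Cn, K A ->
  forall e : term_algebra Cn P -> A, is_hom e ->
    (forall alpha beta, H (alpha, beta) -> e alpha = e beta) ->
    e phi = e psi.

(* Main.v *)
Require Import Defs.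
From mathcomp Require Import all_boot.
From mathcomp Require Import boolp classical_sets.

Set Implicit Arguments.
Unset Strict Implicit.
Unset Printing Implicit Defensive.

Local Open Scope classical_set_scope.

(* Both consequence relations are closure operators: [e] follows from [H] when
   [e] lies in every member containing [H] of a family of congruences of the
   formula algebra [F].  For [entails] these are the kernels of the composites
   of an endomorphism of [F] with a meaning function, for [Alg_m] the kernels of
   the evaluations in the algebras [mng_M(F)].  As [F] is free, an evaluation in
   [mng_M(F)] lifts along [mng_M] to an endomorphism of [F], so the two families
   coincide.

   A deductive system is contained in such a closure operator as soon as every
   member of the family is closed under it.  Sets closed under a substitutional
   system are stable under inverse images by endomorphisms, so it suffices that
   the kernels of the meaning functions be closed, which is soundness. *)

Fixpoint term_eval (Cn : signature) (P : Type) (A : algebra Cn) (v : P -> A)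
    (t : term Cn P) : A :=
  match t with
  | Atom p => v p
  | App c ts => op A c (fun i => term_eval v (ts i))
  end.

Lemma term_eval_hom (Cn : signature) (P : Type) (A : algebra Cn) (v : P -> A) :
  is_hom (A := term_algebra Cn P) (term_eval v).
Proof. by []. Qed.

Lemma is_hom_comp (Cn : signature) (A B C : algebra Cn) (f : A -> B)
    (g : B -> C) :
  is_hom f -> is_hom g -> is_hom (g \o f).
Proof. by move=> f_hom g_hom c a /=; rewrite f_hom g_hom. Qed.

Lemma term_hom_ext (Cn : signature) (P : Type) (A : algebra Cn)
    (f g : term_algebra Cn P -> A) :
  is_hom f -> is_hom g -> (forall p, f (Atom Cn p) = g (Atom Cn p)) -> f = g.
Proof.
move=> f_hom g_hom fg_atom; apply/funext; elim=> [//|c ts fg_ts].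
by rewrite (f_hom c ts) (g_hom c ts); congr (op A c _); apply/funext.
Qed.

Lemma term_hom_lift (Cn : signature) (P : Type) (A B : algebra Cn)
    (g : A -> B) (e : term_algebra Cn P -> B) :
  is_hom g -> is_hom e -> (forall p, range g (e (Atom Cn p))) ->
  exists2 f : term_algebra Cn P -> A, is_hom f & g \o f = e.
Proof.
move=> g_hom e_hom e_range.
have /choice[v gv] p : exists x, g x = e (Atom Cn p).
  by have [x _ gx] := e_range p; exists x.
exists (term_eval v); first exact: term_eval_hom.
by apply: term_hom_ext => //; apply: is_hom_comp => //; apply: term_eval_hom.
Qed.

Lemma ker_comp_inj (T U V : Type) (f : T -> U) (g : U -> V) :
  injective g -> ker (g \o f) = ker f.
Proof.
by move=> g_inj; apply/seteqP; split=> e; [apply: g_inj|apply: congr1].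
Qed.

Section HomImage.
Variables (Cn : signature) (A B : algebra Cn) (h : A -> B) (h_hom : is_hom h).

Definition hom_image_val (y : hom_image h_hom) : B := sval y.

Lemma hom_image_val_inj : injective hom_image_val.
Proof. by move=> [x hx] [y hy] /= xy; apply: eq_exist. Qed.

Lemma hom_image_val_hom : is_hom hom_image_val.
Proof. by []. Qed.

Definition corestrict (x : A) : hom_image h_hom := exist _ (h x) (imageT h x).

Lemma corestrict_hom : is_hom corestrict.
Proof. by move=> c a; apply/hom_image_val_inj/h_hom. Qed.

End HomImage.
Arguments hom_image_val_inj {Cn A B h} h_hom.
Arguments hom_image_val_hom {Cn A B h} h_hom.

Definition hom_kernels (Cn : signature) (A B : algebra Cn) :
    set (set (A * A)) :=
  [set ker e | e in @is_hom Cn A B].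
Arguments hom_kernels {Cn} A B.

Lemma hom_kernels_hom_image (Cn : signature) (P : Type) (A B : algebra Cn)
    (h : A -> B) (h_hom : is_hom h) :
  hom_kernels (term_algebra Cn P) (hom_image h_hom) =
  [set ker (h \o f) | f in @is_hom Cn (term_algebra Cn P) A].
Proof.
apply/seteqP; split=> [_ [e e_hom <-]|_ [f f_hom <-]].
  have [f f_hom hf] := term_hom_lift h_hom
    (is_hom_comp e_hom (hom_image_val_hom h_hom))
    (fun p => svalP (e (Atom Cn p))).
  by exists f => //; rewrite hf (ker_comp_inj _ (hom_image_val_inj h_hom)).
exists (corestrict h_hom \o f).
  exact: is_hom_comp f_hom (corestrict_hom h_hom).
by rewrite -(ker_comp_inj _ (hom_image_val_inj h_hom)).
Qed.

Definition evaluation_kernels (Cn : signature) (P : Type)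
    (K : algebra Cn -> Prop) : set (set (term Cn P * term Cn P)) :=
  [set S | exists2 A, K A & hom_kernels (term_algebra Cn P) A S].
Arguments evaluation_kernels {Cn} P K.

Lemma valid_implicationP (Cn : signature) (P : Type) (K : algebra Cn -> Prop)
    (H : set (term_algebra Cn P * term_algebra Cn P))
    (phi psi : term_algebra Cn P) :
  valid_implication K H phi psi <->
  smallest (evaluation_kernels P K) H (phi, psi).
Proof.
split=> [valid _ [[A KA [e e_hom <-]] HS]|closed A KA e e_hom eH].
  by apply: valid e_hom _ => // alpha beta /HS.
apply: (closed (ker e)); split; first by exists A => //; exists e.
by move=> [alpha beta]; apply: eH.
Qed.

Section DeductiveSystems.
Variable L : logic.
Implicit Types (D : relation2 L) (S H : set (formula L * formula L)).
Implicit Types (C : set (set (formula L * formula L))).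

Lemma closed_under_preimage D S (f : formula L -> formula L) :
  substitutional D -> is_hom f -> closed_under D S ->
  closed_under D (pair_map f @^-1` S).
Proof.
move=> D_subst f_hom S_closed H e HfS De.
by apply: S_closed (D_subst f f_hom H e De); rewrite image_sub.
Qed.

Lemma sub_smallest_closed_under D C H :
  (forall S, C S -> closed_under D S) -> D H `<=` smallest C H.
Proof. by move=> C_closed e De S [CS HS]; apply: C_closed HS De. Qed.

Lemma closed_under_smallest C S : C S -> closed_under (smallest C) S.
Proof. by move=> CS H e HS; apply: smallest_sub. Qed.

Lemma deductive_system_smallest C : deductive_system (smallest C : relation2 L).
Proof.
split=> [H e|H K e HK eH S [CS KS]|H K e eH HK S [CS KS]].
- exact: sub_gen_smallest.
- exact: smallest_sub CS (subset_trans HK KS) _ eH.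
- by apply: (smallest_sub CS) eH => e' /HK; apply: smallest_sub.
Qed.

Lemma substitutional_smallest C :
  (forall (f : formula L -> formula L) S,
     is_hom f -> C S -> C (pair_map f @^-1` S)) ->
  substitutional (smallest C : relation2 L).
Proof.
move=> C_preimage f f_hom H e eH S [CS]; rewrite image_sub => HfS.
exact: smallest_sub (C_preimage f S f_hom CS) HfS _ eH.
Qed.

End DeductiveSystems.

Section Entails.
Variable L : logic.

Definition meaning_kernels : set (set (formula L * formula L)) :=
  \bigcup_M [set ker (mng M \o f) | f in @is_hom _ (formula_algebra L) _].

Lemma entailsE : @entails L = smallest meaning_kernels.
Proof.
apply/funext => H; apply/seteqP; split=> e.
  by move=> He _ [[M _ [f f_hom <-]] HS]; apply: He => //; rewrite image_sub.
move=> He f f_hom M; rewrite image_sub => HS.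
by apply: (He (ker (mng M \o f))); split=> //; exists M => //; exists f.
Qed.

Lemma meaning_kernels_ker (M : model L) : meaning_kernels (ker (mng M)).
Proof. by exists M => //; exists id. Qed.

Lemma meaning_kernels_preimage (f : formula L -> formula L) S :
  is_hom f -> meaning_kernels S -> meaning_kernels (pair_map f @^-1` S).
Proof.
move=> f_hom [M _ [g g_hom <-]].
by exists M => //; exists (g \o f) => //; apply: is_hom_comp.
Qed.

Lemma closed_under_meaning_kernels (D : relation2 L) S :
  substitutional D -> sound D -> meaning_kernels S -> closed_under D S.
Proof.
move=> D_subst D_sound [M _ [f f_hom <-]].
exact: closed_under_preimage D_subst f_hom (D_sound M).
Qed.

Lemma evaluation_kernels_Alg_m :
  evaluation_kernels (atom L) (@Alg_m L) = meaning_kernels.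
Proof.
apply/seteqP; split=> [S [_ [M ->]]|S [M _]].
  by rewrite hom_kernels_hom_image => S_ker; exists M.
rewrite -(hom_kernels_hom_image (atom L) (mng_hom M)) => S_ker.
by exists (hom_image (mng_hom M)) => //; exists M.
Qed.

End Entails.

Theorem theorem2p5 (L : logic) :
  [/\ deductive_system (@entails L),
      substitutional (@entails L),
      sound (@entails L)
    & forall D : relation2 L,
        deductive_system D -> substitutional D -> sound D ->
        forall H e, D H e -> entails H e]
  /\
  (forall (H : set (formula L * formula L)) (phi psi : formula L),
     entails H (phi, psi) <-> valid_implication (@Alg_m L) H phi psi).
Proof.
rewrite entailsE; split; last first.
  by move=> H phi psi; rewrite valid_implicationP evaluation_kernels_Alg_m.
split.
- exact: deductive_system_smallest.
- by apply: substitutional_smallest => f S; apply: meaning_kernels_preimage.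
- by move=> M; apply: closed_under_smallest; apply: meaning_kernels_ker.
- move=> D _ D_subst D_sound H; apply: sub_smallest_closed_under => S.
  exact: closed_under_meaning_kernels.
Qed.
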